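(* Let $K$ be a field of characteristic zero, and let $N=R\oplus M$ be the Novikov algebra over $K$ that is the zero split extension of $R$ by $M$, where $R=Ke_{-1}\oplus Ke_0$ is the subalgebra of the Novikov-Witt algebra $L_1$ and $M=\bigoplus_{i\ge -1}Kf_i$ is an isomorphic copy of $L_1$ regarded as an $R$-bimodule. Then $N$ is Lie-solvable of index $3$, and $[N,N]$ is not nilpotent.
   Context: Algebras are not necessarily associative. A Novikov algebra over $K$ is a $K$-vector space with a bilinear product satisfying $(x,y,z)=(y,x,z)$ and $(xy)z=(xz)y$, where $(x,y,z)=(xy)z-x(yz)$. The Novikov-Witt algebra $L_1$ is the Novikov algebra with linear basis $e_n=x^{n+1}\partial$, $n\ge -1$ (where $\partial=\frac{\partial}{\partial x}$ on $K[x]$) and product $f\partial\circ g\partial=fg'\partial$; thus $e_i\circ e_j=(j+1)e_{i+j}$ for $i,j\ge -1$ (when $i=j=-1$ the coefficient is $0$ and the product is $0$). The subspace $R=Ke_{-1}\oplus Ke_0$ is a subalgebra. $M$ is a vector space with basis $f_i$, $i\ge -1$, with $R$-bimodule structure $e_i\circ f_j=(j+1)f_{i+j}$ and $f_j\circ e_i=(i+1)f_{i+j}$ for $i\in\{-1,0\}$ and $j\ge -1$ (terms with coefficient $0$ are $0$). The zero split extension of $R$ by $M$ is the vector space $N=R\oplus M$ with product $(r_1+m_1)(r_2+m_2)=r_1\circ r_2+r_1\circ m_2+m_1\circ r_2$ for $r_1,r_2\in R$, $m_1,m_2\in M$; it is a Novikov algebra. For a Novikov algebra $N$, the commutator $[x,y]=xy-yx$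 makes $N$ a Lie algebra $N^{(-)}$. $N$ is Lie-solvable of index $n$ if $N^{(-)}$ is solvable and $n$ is the least integer such that the $n$-th term of its derived series vanishes, the series being $\mathfrak g^{(0)}=\mathfrak g$, $\mathfrak g^{(m+1)}=[\mathfrak g^{(m)},\mathfrak g^{(m)}]$. $[N,N]$ is the linear span of all commutators, regarded as an algebra under the product of $N$ (it is an ideal of $N$). For an algebra $A$, put $A^1=A$ and $A^m=\sum_{i=1}^{m-1}A^iA^{m-i}$ for $m\ge 2$; $A$ is nilpotent if $A^m=0$ for some positive integer $m$. *)

(* Defs.v *)
From HB Require Import structures.
From mathcomp Require Import all_boot all_order all_algebra.
From mathcomp Require Import qpoly.
From mathcomp Require Import boolp classical_sets.
From mathcomp Require Import ring zify.

Set Implicit Arguments.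
Unset Strict Implicit.
Unset Printing Implicit Defensive.

Import GRing.Theory.
Local Open Scope classical_set_scope.
Local Open Scope ring_scope.

Reserved Notation "x ∘ y" (at level 40, left associativity).

HB.mixin Record Lmodule_isNonassocAlgebra (K : fieldType) V
    of GRing.Lmodule K V := {
  namul : V -> V -> V;
  namul_linearl : forall y : V, linear (namul^~ y);
  namul_linearr : forall x : V, linear (namul x)
}.

#[short(type="naAlgType")]
HB.structure Definition NonassocAlgebra (K : fieldType) :=
  { V of GRing.Lmodule K V & Lmodule_isNonassocAlgebra K V }.

Notation "x ∘ y" := (namul x y) : ring_scope.

Definition associator (K : fieldType) (A : naAlgType K) (x y z : A) : A :=
  (x ∘ y) ∘ z - x ∘ (y ∘ z).

HB.mixin Record NonassocAlgebra_isNovikov (K : fieldType) A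
    of NonassocAlgebra K A := {
  associator_lsym : forall x y z : A, associator x y z = associator y x z;
  namul_rcomm : forall x y z : A, (x ∘ y) ∘ z = (x ∘ z) ∘ y
}.

#[short(type="novikovType")]
HB.structure Definition Novikov (K : fieldType) :=
  { A of NonassocAlgebra K A & NonassocAlgebra_isNovikov K A }.

Definition lin_span (K : fieldType) (V : lmodType K) (S : set V) : set V :=
  [set x | exists (n : nat) (c : 'I_n -> K) (v : 'I_n -> V),
     (forall i, S (v i)) /\ x = \sum_(i < n) c i *: v i].

Section Algebra.
Variables (K : fieldType) (A : naAlgType K).
Implicit Types (x y : A) (U W : set A).

Definition lie_bracket x y : A := x ∘ y - y ∘ x.

Definition subspace_mul U W : set A :=
  lin_span [set x ∘ y | x in U & y in W].

Definition subspace_bracket U W : set A :=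
  lin_span [set lie_bracket x y | x in U & y in W].

Definition derived_series (n : nat) : set A :=
  iter n (fun U => subspace_bracket U U) setT.

Definition lie_solvable : Prop := exists n, derived_series n = [set 0].

Definition lie_solvable_of_index (n : nat) : Prop :=
  lie_solvable /\ derived_series n = [set 0] /\
  forall m, derived_series m = [set 0] -> (n <= m)%N.

Definition commutator_ideal : set A := subspace_bracket setT setT.

(* [alg_pow_fuel U k m] is the m-th power U^m of U as soon as m <= k; the
   first argument only serves to make the course-of-values recursion
   structural, see [alg_pow1] and [alg_powE]. *)
Fixpoint alg_pow_fuel U (k m : nat) : set A :=
  if k is k'.+1 then
    if (m <= 1)%N then U
    else lin_span (\bigcup_(i in [set i | (1 <= i <= m - 1)%N])
           subspace_mul (alg_pow_fuel U k' i) (alg_pow_fuel U k' (m - i)))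
  else U.

(* Only meaningful for 0 < m; U^0 is the dummy value U. *)
Definition alg_pow U (m : nat) : set A := alg_pow_fuel U m m.

(* For a subspace U closed under the product, this is nilpotency of U as an
   algebra in its own right: all the powers of U are contained in U. *)
Definition nilpotent U : Prop :=
  exists m : nat, (0 < m)%N /\ alg_pow U m = [set 0].

Lemma alg_pow_fuelE U k m : (m <= k)%N -> alg_pow_fuel U k m = alg_pow U m.
Proof.
suff H n k1 k2 j : (j <= n)%N -> (j <= k1)%N -> (j <= k2)%N ->
    alg_pow_fuel U k1 j = alg_pow_fuel U k2 j.
  by move=> mk; apply: (H m).
elim: n k1 k2 j => [|n IHn] [|k1] [|k2] [|[|j]] //=.
rewrite !ltnS => jn jk1 jk2; congr lin_span; apply: eq_bigcupr => i /=.
rewrite subn1 /= => /andP[i_gt0 ij].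
have ji : (j.+2 - i <= j.+1)%N by rewrite leq_subLR -(add1n j.+1) leq_add2r.
by congr subspace_mul; apply: IHn; apply: leq_trans; eassumption.
Qed.

Lemma alg_pow1 U : alg_pow U 1 = U.
Proof. by []. Qed.

Lemma alg_powE U m : (2 <= m)%N ->
  alg_pow U m = lin_span (\bigcup_(i in [set i | (1 <= i <= m - 1)%N])
                   subspace_mul (alg_pow U i) (alg_pow U (m - i))).
Proof.
case: m => [|[|m]] // _; congr lin_span; apply: eq_bigcupr => i iP.
have /andP[i_gt0 im] : (0 < i <= m.+2 - 1)%N := iP; rewrite subn1 in im.
have mi : (m.+2 - i <= m.+1)%N by rewrite leq_subLR -(add1n m.+1) leq_add2r.
by rewrite -(alg_pow_fuelE U im) -(alg_pow_fuelE U mi).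
Qed.

End Algebra.

Arguments derived_series {K} A n.
Arguments lie_solvable {K} A.
Arguments lie_solvable_of_index {K} A n.
Arguments commutator_ideal {K} A.

(* The vector space of L_1, with the polynomial f standing for the vector
   field f d/dx. *)
Definition witt (K : fieldType) : Type := {poly K}.

HB.instance Definition _ (K : fieldType) := GRing.Lmodule.on (witt K).

Section Witt.
Variable K : fieldType.

Definition witt_mul (f g : witt K) : witt K :=
  (f : {poly K}) * (g : {poly K})^`().

Lemma witt_mul_linearl g : linear (witt_mul^~ g).
Proof. by move=> a f1 f2; rewrite /witt_mul mulrDl scalerAl. Qed.

Lemma witt_mul_linearr f : linear (witt_mul f).
Proof. by move=> a g1 g2; rewrite /witt_mul derivD derivZ mulrDr scalerAr. Qed.

HB.instance Definition _ := Lmodule_isNonassocAlgebra.Build K (witt K)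
  witt_mul_linearl witt_mul_linearr.

Lemma witt_lsym (x y z : witt K) : associator x y z = associator y x z.
Proof. by rewrite /associator /namul /= /witt_mul !derivM; ring. Qed.

Lemma witt_rcomm (x y z : witt K) : (x ∘ y) ∘ z = (x ∘ z) ∘ y.
Proof. by rewrite /namul /= /witt_mul mulrAC. Qed.

HB.instance Definition _ := NonassocAlgebra_isNovikov.Build K (witt K)
  witt_lsym witt_rcomm.

(* e_n = x^(n+1) d/dx; only meaningful for -1 <= n. *)
Definition witt_e (n : int) : witt K := 'X^(absz (n + 1)).

Lemma witt_e_mul (i j : int) : -1 <= i -> -1 <= j ->
  witt_e i ∘ witt_e j = (j + 1)%:~R *: witt_e (i + j).
Proof.
move=> i_ge j_ge.
have [m ->] : exists m : nat, i = m%:Z - 1 by exists (absz (i + 1)); lia.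
have [n ->] : exists n : nat, j = n%:Z - 1 by exists (absz (j + 1)); lia.
rewrite /witt_e !subrK /namul /= /witt_mul derivXn.
case: n => [|n]; first by rewrite mulr0n mulr0 scale0r.
rewrite mulrnAr -exprD -scaler_nat; congr (_ *: 'X^_); lia.
Qed.

End Witt.

(* The subspace R = K e_{-1} + K e_0 of L_1, as the polynomials of size at
   most 2; see [witt_subP]. *)
Definition witt_sub (K : fieldType) : Type := {poly_2 K}.

HB.instance Definition _ (K : fieldType) := GRing.Lmodule.on (witt_sub K).

Section WittSub.
Variable K : fieldType.

Definition witt_incl (r : witt_sub K) : witt K := polyn r.

Lemma witt_subP (p : witt K) :
  (exists r : witt_sub K, p = witt_incl r) <->
  (exists a b : K, p = a *: witt_e K (-1) + b *: witt_e K 0).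
Proof.
rewrite /witt_e /= expr0 expr1; split=> [[r ->]|[a [b ->]]].
  exists (polyn r)`_0, (polyn r)`_1; apply/polyP=> i.
  rewrite coefD !coefZ coef1 coefX.
  case: i => [|[|i]] /=; rewrite ?(mulr0, mulr1, addr0, add0r) //.
  by rewrite nth_default // (leq_trans (size_npoly r)).
have sz : (size (a *: 1 + b *: 'X : {poly K})%R <= 2)%N.
  rewrite (leq_trans (size_polyD _ _)) // geq_max.
  by rewrite !(leq_trans (size_scale_leq _ _)) ?size_polyX ?size_poly1.
by exists (NPoly sz).
Qed.

Lemma witt_incl_linear : linear witt_incl.
Proof. by []. Qed.

Lemma witt_incl_inj : injective witt_incl.
Proof. exact: val_inj. Qed.

Lemma witt_sub_mul_size (r s : witt_sub K) :
  (size (witt_incl r ∘ witt_incl s : {poly K}) <= 2)%N.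
Proof.
rewrite /namul /= /witt_mul.
have dsz : (size (polyn s)^`() <= 1)%N.
  by rewrite (leq_trans (size_poly _ _)) // -subn1 leq_subLR size_npoly.
rewrite (leq_trans (size_polyMleq _ _)) // -subn1 leq_subLR.
by rewrite addnC (leq_trans (leq_add dsz (size_npoly r))).
Qed.

Definition witt_sub_mul (r s : witt_sub K) : witt_sub K :=
  NPoly (witt_sub_mul_size r s).

Lemma witt_sub_mul_linearl s : linear (witt_sub_mul^~ s).
Proof.
by move=> a r1 r2; apply: witt_incl_inj; rewrite /= namul_linearl.
Qed.

Lemma witt_sub_mul_linearr r : linear (witt_sub_mul r).
Proof.
by move=> a r1 r2; apply: witt_incl_inj; rewrite /= namul_linearr.
Qed.

HB.instance Definition _ := Lmodule_isNonassocAlgebra.Build K (witt_sub K)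
  witt_sub_mul_linearl witt_sub_mul_linearr.

Lemma witt_inclM (r s : witt_sub K) :
  witt_incl (r ∘ s) = witt_incl r ∘ witt_incl s.
Proof. by []. Qed.

End WittSub.

(* The zero split extension N = R + M, where M is the vector space of L_1 and
   R acts on it on both sides by the product of L_1; in terms of the basis
   f_j = e_j of M the actions are thus given by [witt_e_mul]. *)
Definition witt_split (K : fieldType) : Type := (witt_sub K * witt K)%type.

HB.instance Definition _ (K : fieldType) := GRing.Lmodule.on (witt_split K).

Section WittSplit.
Variable K : fieldType.

Definition witt_split_mul (u v : witt_split K) : witt_split K :=
  (u.1 ∘ v.1, witt_incl u.1 ∘ v.2 + u.2 ∘ witt_incl v.1).

Lemma witt_split_mul_linearl v : linear (witt_split_mul^~ v).
Proof.
move=> a u1 u2; rewrite /witt_split_mul; congr pair; first exact: namul_linearl.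
rewrite -[RHS]/(_ *: (_ + _) + (_ + _)) scalerDr addrACA.
by congr (_ + _); rewrite -namul_linearl.
Qed.

Lemma witt_split_mul_linearr u : linear (witt_split_mul u).
Proof.
move=> a v1 v2; rewrite /witt_split_mul; congr pair; first exact: namul_linearr.
rewrite -[RHS]/(_ *: (_ + _) + (_ + _)) scalerDr addrACA.
by congr (_ + _); rewrite -namul_linearr.
Qed.

HB.instance Definition _ := Lmodule_isNonassocAlgebra.Build K (witt_split K)
  witt_split_mul_linearl witt_split_mul_linearr.

Lemma witt_split_lsym (x y z : witt_split K) :
  associator x y z = associator y x z.
Proof.
congr pair; first by apply: witt_incl_inj; exact: witt_lsym.
rewrite /namul /= /witt_split_mul /= /namul /= /witt_mul !(derivM, derivD).
by ring.
Qed.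

Lemma witt_split_rcomm (x y z : witt_split K) : (x ∘ y) ∘ z = (x ∘ z) ∘ y.
Proof.
congr pair; first by apply: witt_incl_inj; exact: witt_rcomm.
rewrite /namul /= /witt_split_mul /= /namul /= /witt_mul.
by ring.
Qed.

HB.instance Definition _ := NonassocAlgebra_isNovikov.Build K (witt_split K)
  witt_split_lsym witt_split_rcomm.

End WittSplit.

(* Main.v *)
Require Import Defs.
From HB Require Import structures.
From mathcomp Require Import all_boot all_order all_algebra.
From mathcomp Require Import qpoly boolp classical_sets.
Local Open Scope ring_scope.

(** Elements of N are pairs (r, p) of a polynomial r of degree at most 1 and an
arbitrary polynomial p, and the product is
  (r, p)(s, q) = (r s', r q' + p s').
The first component of a commutator is the Wronskian r s' - s r', whose
derivative r s'' - s r'' vanishes because r and s have degree at most 1; so the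
first component is constant on [N, N].  The Wronskian of two constants is 0, so
the second derived term lies in M, and M has zero product, so the third derived
term vanishes ([derived_series3]).

For the lower bounds put E = (1, 0), that is e_(-1).  Multiplication by E on
the left sends (0, p) to (0, p'), while M E = 0 because 1' = 0.  In
characteristic zero every polynomial is a derivative, so M = E M = [E, M].
Since [N, N] contains E, being the Wronskian of 1 and x, it follows that
[N, N] contains M and E M = M, hence M is contained in the second derived term
and in every power of [N, N]. *)

Set Implicit Arguments.
Unset Strict Implicit.
Unset Printing Implicit Defensive.

Import GRing.Theory.
Local Open Scope classical_set_scope.

Lemma mem_lin_span (K : fieldType) (V : lmodType K) (S : set V) (x : V) :
  S x -> lin_span S x.
Proof.
move=> Sx; exists 1, (fun=> 1), (fun=> x); split=> //.
by rewrite big_ord1 scale1r.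
Qed.

Lemma lin_span0 (K : fieldType) (V : lmodType K) (S : set V) : lin_span S 0.
Proof.
by exists 0, (fun=> 0), (fun=> 0); split; [case | rewrite big_ord0].
Qed.

(** Bounds a span from above by a linear condition on its generators. *)
Lemma lin_span_ker (K : fieldType) (V W : lmodType K) (f : {linear V -> W})
    (S : set V) :
  (forall x, S x -> f x = 0) -> forall x, lin_span S x -> f x = 0.
Proof.
move=> fS0 _ [n [c [v [Sv ->]]]].
by rewrite linear_sum big1 // => i _; rewrite linearZ /= fS0 ?scaler0.
Qed.

(** Integrating termwise divides by positive integers, which is where the
characteristic matters. *)
Lemma deriv_surj (K : fieldType) (q : {poly K}) :
  [pchar K] =i pred0 -> exists p : {poly K}, p^`() = q.
Proof.
move=> /pcharf0P charK0.
exists (\poly_(i < (size q).+1) (q`_i.-1 / i%:R)).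
apply/polyP=> i; rewrite coef_deriv coef_poly ltnS /=.
case: ltnP => [_|le_qi]; last by rewrite mul0rn nth_default.
by rewrite -[LHS]mulr_natr divfK // charK0.
Qed.

Section Split.
Variable K : fieldType.
Local Notation N := (witt_split K).

(** Reading the two components in K[x] itself makes the product of N a formula
in ordinary products and derivatives, and lets the terms of the derived series
be bounded by kernels of linear maps into K[x]. *)
Definition split_fst (u : N) : {poly K} := polyn u.1.
Definition split_snd (u : N) : {poly K} := u.2.

Lemma split_fst_linear : linear split_fst. Proof. by []. Qed.
HB.instance Definition _ :=
  GRing.isLinear.Build K N {poly K} _ split_fst split_fst_linear.

Lemma split_eq (u v : N) :
  split_fst u = split_fst v -> split_snd u = split_snd v -> u = v.
Proof.
case: u v => [r p] [s q]; rewrite /split_fst /split_snd /= => rs ->.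
by congr pair; apply: val_inj.
Qed.

Lemma split_fstM (u v : N) :
  split_fst (u ∘ v) = split_fst u * (split_fst v)^`().
Proof. by []. Qed.

Lemma split_sndM (u v : N) :
  split_snd (u ∘ v) =
    split_fst u * (split_snd v)^`() + split_snd u * (split_fst v)^`().
Proof. by []. Qed.

Lemma split_fst_bracket (u v : N) :
  split_fst (lie_bracket u v) =
    split_fst u * (split_fst v)^`() - split_fst v * (split_fst u)^`().
Proof. by []. Qed.

Lemma split_snd_bracket (u v : N) :
  split_snd (lie_bracket u v) =
    split_fst u * (split_snd v)^`() + split_snd u * (split_fst v)^`()
    - (split_fst v * (split_snd u)^`() + split_snd v * (split_fst u)^`()).
Proof. by []. Qed.

(** Elements of R have degree at most 1 as polynomials. *)
Lemma split_fst_deriv2 (u : N) : (split_fst u)^`()^`() = 0.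
Proof.
apply/polyP=> i; rewrite !coef_deriv nth_default ?coef0 ?mul0rn //.
exact: leq_trans (size_npoly u.1) _.
Qed.

(** The derivative of the Wronskian r s' - s r' is r s'' - s r''. *)
Lemma derived_series1 (u : N) :
  derived_series (N : novikovType K) 1 u -> (split_fst u)^`() = 0.
Proof.
apply: (@lin_span_ker _ _ _ (@deriv K \o split_fst)) => _ [x _ [y _ <-]] /=.
rewrite split_fst_bracket derivB !derivM !split_fst_deriv2 !mulr0 !addr0.
by rewrite mulrC subrr.
Qed.

(** The Wronskian of two constants is 0. *)
Lemma derived_series2 (u : N) :
  derived_series (N : novikovType K) 2 u -> split_fst u = 0.
Proof.
apply: lin_span_ker => _ [x /derived_series1 x'0 [y /derived_series1 y'0 <-]].
by rewrite /= split_fst_bracket x'0 y'0 !mulr0 subrr.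
Qed.

Lemma derived_series3 : derived_series (N : novikovType K) 3 = [set 0].
Proof.
apply/seteqP; split=> [u|_ ->]; last exact: lin_span0.
apply: (@lin_span_ker _ _ _ idfun).
move=> _ [x /derived_series2 x0 [y /derived_series2 y0 <-]] /=.
apply: split_eq.
  by rewrite split_fst_bracket x0 y0 !mul0r subrr.
by rewrite split_snd_bracket x0 y0 linear0 !mul0r !mulr0 addr0 subrr.
Qed.

Lemma size_e_neg1 : (size (1%R : {poly K}) <= 2)%N.
Proof. by rewrite size_poly1. Qed.

Lemma size_e0 : (size ('X : {poly K}) <= 2)%N.
Proof. by rewrite size_polyX. Qed.

Definition split_e_neg1 : N := (NPoly size_e_neg1, 0).
Definition split_e0 : N := (NPoly size_e0, 0).
Definition split_M (p : {poly K}) : N := (0, p).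

Lemma mul_e_neg1_M (p : {poly K}) : split_e_neg1 ∘ split_M p = split_M p^`().
Proof.
apply: split_eq; first by rewrite split_fstM linear0 mulr0.
by rewrite split_sndM linear0 mulr0 addr0 mul1r.
Qed.

Lemma bracket_e_neg1_M (p : {poly K}) :
  lie_bracket split_e_neg1 (split_M p) = split_M p^`().
Proof.
rewrite /lie_bracket mul_e_neg1_M (_ : split_M p ∘ _ = 0) ?subr0 //.
apply: split_eq; first by rewrite split_fstM mul0r.
by rewrite split_sndM mul0r add0r -[X in X^`()]/(1%:P) derivC mulr0.
Qed.

Lemma bracket_e_neg1_e0 : lie_bracket split_e_neg1 split_e0 = split_e_neg1.
Proof.
apply: split_eq.
  by rewrite split_fst_bracket /= derivX derivC mulr0 mulr1 subr0.
by rewrite split_snd_bracket /split_snd /= linear0 !mulr0 !mul0r addr0 subr0.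
Qed.

Hypothesis charK0 : [pchar K] =i pred0.

(** Every element of M is (0, p') for some p, hence equals [E, (0, p)]. *)
Lemma subspace_bracket_M (U : set N) (q : {poly K}) :
  U split_e_neg1 -> (forall p, U (split_M p)) ->
  subspace_bracket (A := N : novikovType K) U U (split_M q).
Proof.
move=> Ue UM; have [p <-] := deriv_surj q charK0.
apply: mem_lin_span; exists split_e_neg1 => //; exists (split_M p) => //.
exact: bracket_e_neg1_M.
Qed.

Lemma commutator_ideal_e_neg1 :
  commutator_ideal (N : novikovType K) split_e_neg1.
Proof.
apply: mem_lin_span; exists split_e_neg1 => //; exists split_e0 => //.
exact: bracket_e_neg1_e0.
Qed.

Lemma commutator_ideal_M (q : {poly K}) :
  commutator_ideal (N : novikovType K) (split_M q).
Proof. exact: subspace_bracket_M. Qed.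

Lemma derived_series_M (m : nat) (q : {poly K}) :
  (m <= 2)%N -> derived_series (N : novikovType K) m (split_M q).
Proof.
case: m => [|[|[|]]] // _; first exact: commutator_ideal_M.
apply: subspace_bracket_M; first exact: commutator_ideal_e_neg1.
exact: commutator_ideal_M.
Qed.

(** For U = [N, N] and m > 1, the summand U U^(m-1) of U^m alone already
contains E M = M. *)
Lemma alg_pow_M (m : nat) (q : {poly K}) : (0 < m)%N ->
  alg_pow (commutator_ideal (N : novikovType K)) m (split_M q).
Proof.
elim: m q => // -[_|m IHm] q _; first exact: commutator_ideal_M.
rewrite alg_powE //; apply: mem_lin_span; exists 1 => //=.
have [p <-] := deriv_surj q charK0; rewrite subn1.
apply: mem_lin_span; exists split_e_neg1; first exact: commutator_ideal_e_neg1.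
by exists (split_M p); [exact: IHm | exact: mul_e_neg1_M].
Qed.

Lemma split_M1_neq0 : split_M 1 <> 0.
Proof. by move=> /(congr1 snd) /eqP; rewrite /= oner_eq0. Qed.

End Split.

Theorem proposition1 (K : fieldType) (charK0 : [pchar K] =i pred0) :
  lie_solvable_of_index (witt_split K : novikovType K) 3 /\
  ~ nilpotent (commutator_ideal (witt_split K : novikovType K)).
Proof.
split.
  split; first by exists 3; exact: derived_series3.
  split; first exact: derived_series3.
  move=> m Dm0; rewrite leqNgt; apply/negP => m_le2.
  have := derived_series_M charK0 1 m_le2.
  by rewrite Dm0; exact: split_M1_neq0.
move=> [m [m_gt0 Um0]].
have := alg_pow_M charK0 1 m_gt0.
by rewrite Um0; exact: split_M1_neq0.
Qed.
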